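(* Let $\lambda_1,\dots,\lambda_N$ be eigenvalues of the spectral problem (SP) with corresponding eigenfunctions $W_1,\dots,W_N$, and let $A$, $B$, $C$ and $c_{sj}$ be the matrices and coefficients defined in the context. Suppose that $\lambda_1,\dots,\lambda_N$ are distinct and that for each $j\in\{1,\dots,N\}$ there is an $s\in\{0,\dots,r\}$ such that $c_{sj}\neq0$. Then the control system $\dot z=Az+Bu$ with output $y=Cz$ is observable.
   Context: Let $l>0$, $0<l_0<l$, and let $\rho,E,I,m,\varkappa>0$ be constants. The spectral problem (SP) is: find $\lambda$ (an eigenvalue) and a real-valued function $W\not\equiv0$ on $[0,l]$ (an eigenfunction) such that $$\frac{d^4}{dx^4}W(x)=\lambda\frac{\rho}{EI}W(x),\ x\in(0,l)\setminus\{l_0\},\qquad W(0)=W(l)=0,\ W''(0)=W''(l)=0,\ W\in C^2[0,l],$$ $$W'''(l_0-0)-W'''(l_0+0)=\frac{\varkappa-\lambda m}{EI}W(l_0).$$ All eigenvalues are real. Define $\|W\|_H^2=\int_0^l\rho\,W(x)^2\,dx+m\,W(l_0)^2$. Let $N\ge1$, $k,r\ge 0$ be integers, let $\psi_1,\dots,\psi_k$ be given (integrable) actuator shape functions on $[0,l]$ with $\operatorname{supp}\psi_i\cap\{0,l_0,l\}=\emptyset$, and let $l_1,\dots,l_r\in[0,l]$ be the sensor locations. The state is $z=(q_1,p_1,\dots,q_N,p_N)^T\in\mathbb{R}^{2N}$, the control is $u=(u_0,u_1,\dots,u_k)^T\in\mathbb{R}^{k+1}$, and the output is $y\in\mathbb{R}^{r+1}$.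 The matrix $A=\mathrm{diag}(A_1,\dots,A_N)$ is block diagonal with $A_j=\begin{pmatrix}0&1\\-\lambda_j&0\end{pmatrix}$. The $2N\times(k+1)$ matrix $B$ has zero odd-numbered rows, and its $2j$-th row is $(b_{j0},b_{j1},\dots,b_{jk})$ with $$b_{j0}=\frac{W_j(l_0)}{\|W_j\|_H^2},\qquad b_{ji}=\frac{\int_0^l\psi_i(x)W_j''(x)\,dx}{\|W_j\|_H^2},\quad i=1,\dots,k.$$ The $(r+1)\times 2N$ matrix $C$ has rows indexed by $s=0,\dots,r$, with $s$-th row $(c_{s1},0,c_{s2},0,\dots,c_{sN},0)$, where $$c_{0j}=W_j(l_0),\qquad c_{sj}=W_j''(l_s),\quad s=1,\dots,r.$$ Observability is the usual notion for linear time-invariant systems (equivalently, the Kalman observability matrix with blocks $C,CA,\dots,CA^{2N-1}$ has rank $2N$). *)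

(* Defs.v *)
From mathcomp Require Import all_boot all_order all_algebra.
From mathcomp Require Import all_classical all_reals all_analysis.
Import Order.TTheory GRing.Theory Num.Theory.
Import numFieldNormedType.Exports.

Set Implicit Arguments.
Unset Strict Implicit.
Unset Printing Implicit Defensive.

Local Open Scope classical_set_scope.
Local Open Scope ring_scope.

(* Functions on [0, l] are represented by total functions R -> R whose values
   outside [0, l] are never used.  Accordingly the derivative is taken relative
   to a set D: for D = [0, l] it is the ordinary derivative at interior points
   and the one-sided derivative at 0 and at l. *)
Definition diff_quot {R : realType} (f : R -> R) (x y : R) : R :=
  (f y - f x) / (y - x).

Definition derivable_on {R : realType} (D : set R) (f : R -> R) (x : R) : Prop :=
  cvg (diff_quot f x @ within D x^').

Definition derive_on {R : realType} (D : set R) (f : R -> R) (x : R) : R :=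
  lim (diff_quot f x @ within D x^').

Definition deriven_on {R : realType} (D : set R) (n : nat) (f : R -> R) :
    R -> R :=
  iter n (derive_on D) f.

Definition C2_on {R : realType} (D : set R) (f : R -> R) : Prop :=
  [/\ forall x, D x -> derivable_on D f x,
      forall x, D x -> derivable_on D (deriven_on D 1 f) x &
      {within D, continuous (deriven_on D 2 f)}].

Section SpectralProblem.
Context {R : realType}.
Variables (l l0 rho E I m kappa : R).

Let D : set R := `[0, l].

Definition is_eigenpair (lambda : R) (W : R -> R) : Prop :=
  [/\ exists2 x, D x & W x != 0,
      C2_on D W,
      [/\ W 0 = 0, W l = 0, deriven_on D 2 W 0 = 0 & deriven_on D 2 W l = 0],
      forall x, 0 < x < l -> x != l0 ->
        [/\ derivable_on D (deriven_on D 2 W) x,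
            derivable_on D (deriven_on D 3 W) x &
            deriven_on D 4 W x = lambda * (rho / (E * I)) * W x] &
      exists a b : R,
        [/\ deriven_on D 3 W x @[x --> l0^'-] --> a,
            deriven_on D 3 W x @[x --> l0^'+] --> b &
            a - b = (kappa - lambda * m) / (E * I) * W l0]].

Definition sqnormH (W : R -> R) : R :=
  \int[@lebesgue_measure R]_(x in D) (rho * W x ^+ 2) + m * W l0 ^+ 2.

End SpectralProblem.

Definition supp_on {R : realType} (D : set R) (f : R -> R) : set R :=
  closure [set x | D x /\ f x != 0].

Section SystemMatrices.
Context {R : realType}.
Variables (l l0 rho m : R) (N k r : nat).
Variables (psi : 'I_k -> R -> R) (sensor : 'I_r -> R).
Variables (lambda : 'I_N -> R) (W : 'I_N -> R -> R).

Let D : set R := `[0, l].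

(* The state space has dimension \sum_(j < N) 2 = 2N; the j-th block of size
   1 + 1 holds (q_j, p_j).  Modes are numbered from 0 to N - 1. *)

Definition Amx : 'M[R]_(\sum_(j < N) 2) :=
  \mxdiag_(j < N)
     (block_mx 0 1%:M (- lambda j)%:M 0 : 'M[R]_(1 + 1)).

(* The column index ord0 is the point force u_0 at l0, and the column index
   lift ord0 i is the i-th actuator; likewise for the rows of C below. *)
Definition bcoef (j : 'I_N) (i : 'I_k.+1) : R :=
  (if unlift ord0 i is Some i' then
     \int[@lebesgue_measure R]_(x in D) (psi i' x * deriven_on D 2 (W j) x)
   else W j l0) / sqnormH l l0 rho m (W j).

Definition Bmx : 'M[R]_(\sum_(j < N) 2, k.+1) :=
  \mxcol_(j < N) (col_mx 0 (\row_i bcoef j i) : 'M[R]_(1 + 1, k.+1)).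

Definition ccoef (s : 'I_r.+1) (j : 'I_N) : R :=
  if unlift ord0 s is Some s' then deriven_on D 2 (W j) (sensor s')
  else W j l0.

Definition Cmx : 'M[R]_(r.+1, \sum_(j < N) 2) :=
  \mxrow_(j < N) (row_mx (\col_s ccoef s j) 0 : 'M[R]_(r.+1, 1 + 1)).

End SystemMatrices.

Section Observability.
Context {R : realType}.
Variables (n p q : nat).

Definition admissible_control (T : R) (u : R -> 'cV[R]_p) : Prop :=
  forall i, (@lebesgue_measure R).-integrable `[0, T] (fun t => (u t i 0)%:E).

(* Solutions of z' = A z + B u on [0, T] in the Caratheodory sense, that is
   continuous solutions of the equivalent integral equation, so that controls
   need not be continuous. *)
Definition is_trajectory (A : 'M[R]_n) (B : 'M[R]_(n, p)) (T : R)
    (u : R -> 'cV[R]_p) (z : R -> 'cV[R]_n) : Prop :=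
  forall i : 'I_n,
    {within `[0, T], continuous (fun t => z t i 0)} /\
    forall t, 0 <= t <= T ->
      z t i 0 = z 0 i 0 +
        \int[@lebesgue_measure R]_(s in `[0, t]) (A *m z s + B *m u s) i 0.

(* On every time interval [0, T], T > 0, the control and the output determine
   the initial state. *)
Definition observable (A : 'M[R]_n) (B : 'M[R]_(n, p)) (C : 'M[R]_(q, n)) :
    Prop :=
  forall (T : R) (u : R -> 'cV[R]_p) (z1 z2 : R -> 'cV[R]_n),
    0 < T -> admissible_control T u ->
    is_trajectory A B T u z1 -> is_trajectory A B T u z2 ->
    (forall t, 0 <= t <= T -> C *m z1 t = C *m z2 t) ->
    z1 0 = z2 0.

End Observability.

(* Main.v *)
Require Import Defs.
From mathcomp Require Import all_boot all_order all_algebra.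
From mathcomp Require Import all_classical all_reals all_analysis.
Import Order.TTheory GRing.Theory Num.Theory.
Import numFieldNormedType.Exports.
Local Open Scope classical_set_scope.
Local Open Scope ring_scope.

(** Observability is shown through the easy half of Kalman's criterion
    ([observable_of_trivial_unobservable_subspace]): it suffices that x = 0 is
    the only vector with C A^e x = 0 for every e.  Indeed the difference z of
    two trajectories with the same control solves z' = A z
    ([trajectory_sub]), and a matrix w with w z = 0 all along this trajectory
    satisfies w A z = w z' = 0 as well ([trajectory_annihilator]).  Equal
    outputs say that w = C has this property, hence so has every C A^e, and
    evaluating at time 0 concludes.  Since trajectories solve an integral
    equation, the differentiation step takes the form: a continuous function
    all of whose integrals from 0 vanish is zero
    ([continuous_Rintegral_eq0]).

    The criterion is then checked in modal coordinates (q_j, p_j).  On the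
    j-th block A maps (q_j, p_j) to (p_j, - lambda_j q_j), so A^2 is the scalar
    - lambda_j there, and the equations C A^(2e) x = 0 and C A^(2e+1) x = 0
    read sum_j c_sj q_j (- lambda_j)^e = 0 and
    sum_j c_sj p_j (- lambda_j)^e = 0 for all e and s.  As the lambda_j are
    distinct, evaluating a Lagrange polynomial isolates each summand
    ([power_sums_eq0]): c_sj q_j = c_sj p_j = 0.  Choosing, for each j, an s
    with c_sj <> 0 gives q_j = p_j = 0.

    A mode with lambda_j = 0, which drifts linearly instead of oscillating, is
    covered by the same computation: A^2 is then zero on its block. *)

(** * Linear differential systems in integral form *)

(** At interior points this is the fundamental theorem of calculus applied to
    a primitive that is locally constant; the value at 0 follows by right
    continuity. *)
Lemma continuous_Rintegral_eq0 {R : realType} (T : R) (g : R -> R) :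
  0 < T -> {within `[0, T], continuous g} ->
  (forall t, 0 <= t < T -> \int[@lebesgue_measure R]_(s in `[0, t]) g s = 0) ->
  forall t, 0 <= t < T -> g t = 0.
Proof.
move=> T0 cg ig t /andP[t0 tT].
have [cgi g0 _] := (continuous_within_itvP g T0).1 cg.
have gint : (@lebesgue_measure R).-integrable `[0, T] (EFin \o g).
  exact: (continuous_compact_integrable (@segment_compact _ _ _) cg).
have gpos s : 0 < s < T -> g s = 0.
  move=> /andP[s0 sT].
  have cgs : {for s, continuous g} by apply: cgi; rewrite in_itv/= s0 sT.
  have [_ <-] := continuous_FTC1_closed sT gint s0 cgs.
  rewrite -[RHS](derive1_cst (0 : R) s) !derive1E; apply: near_eq_derive.
  near=> y; apply: ig; apply/andP; split; last by near: y; exact: lt_nbhsl.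
  by near: y; exact: lt_le_nbhsr.
have [->|tn0] := eqVneq t 0; last by apply: gpos; rewrite lt0r tn0 t0 tT.
apply/esym/(cvg_unique _ _ g0) => //.
by apply: cvg_near_cst; near=> s; apply: gpos; apply/andP; split.
Unshelve. all: by end_near. Qed.

Section LinearImages.
Context {R : realType} {p n : nat}.
Variables (M : 'M[R]_(p, n)) (F : R -> 'cV[R]_n).

Lemma within_continuous_mulmx (D : set R) (i : 'I_p) :
  (forall k, {within D, continuous (fun t => F t k 0)}) ->
  {within D, continuous (fun t => (M *m F t) i 0)}.
Proof.
move=> cF; under eq_fun do rewrite mxE.
move=> t; apply: cvg_big => [|k _]; first exact: add_continuous.
by apply: cvgM; [exact: cvg_cst | exact: cF].
Qed.

Variables (D : set R).
Hypothesis mD : measurable D.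
Hypothesis iF : forall k,
  (@lebesgue_measure R).-integrable D (fun t => (F t k 0)%:E).

Lemma integrable_mulmx (i : 'I_p) :
  (@lebesgue_measure R).-integrable D (fun t => ((M *m F t) i 0)%:E).
Proof.
under eq_fun do rewrite mxE -sumEFin.
apply: integrable_sum => // k _; under eq_fun do rewrite EFinM.
exact: integrableZl.
Qed.

Lemma Rintegral_mulmx (i : 'I_p) :
  \int[@lebesgue_measure R]_(t in D) (M *m F t) i 0 =
  \sum_k M i k * \int[@lebesgue_measure R]_(t in D) F t k 0.
Proof.
rewrite /Rintegral; under eq_integral do rewrite mxE -sumEFin.
have iMF k : (@lebesgue_measure R).-integrable D
    (fun t => (M i k * F t k 0)%:E).
  by under eq_fun do rewrite EFinM; exact: integrableZl.
rewrite integral_sum// -sum_fine// => [|k _]; last exact: integrable_fin_num.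
apply: eq_bigr => k _; apply: RintegralZl => //; exact: iF.
Qed.

End LinearImages.

Section Trajectories.
Context {R : realType} {n p : nat}.
Variables (A : 'M[R]_n) (B : 'M[R]_(n, p)) (T : R).

Lemma trajectory_integrable u z t k : is_trajectory A B T u z -> t <= T ->
  (@lebesgue_measure R).-integrable `[0, t] (fun s => (z s k 0)%:E).
Proof.
move=> trz tT.
have itT : (@lebesgue_measure R).-integrable `[0, T] (fun s => (z s k 0)%:E).
  exact: (continuous_compact_integrable (@segment_compact _ _ _) (trz k).1).
apply: integrableS itT => //.
exact: subset_itvl.
Qed.

(** Superposition.  Splitting the integral of the difference needs each
    right-hand side to be integrable, which is where the integrability of
    admissible controls enters. *)
Lemma trajectory_sub u z1 z2 : admissible_control T u ->
  is_trajectory A B T u z1 -> is_trajectory A B T u z2 ->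
  is_trajectory A B T (fun=> 0) (fun t => z1 t - z2 t).
Proof.
move=> adu tr1 tr2 i; split.
  have -> : (fun t => (z1 t - z2 t) i 0) = (fun t => z1 t i 0 - z2 t i 0).
    by apply/funext => t; rewrite !mxE.
  by move=> t; apply: cvgB; [exact: (tr1 i).1 | exact: (tr2 i).1].
move=> t t0T; have /andP[t0 tT] := t0T.
have int_rhs z : is_trajectory A B T u z ->
    (@lebesgue_measure R).-integrable `[0, t]
      (fun s => ((A *m z s + B *m u s) i 0)%:E).
  move=> trz.
  have -> : (fun s => ((A *m z s + B *m u s) i 0)%:E) =
      (fun s => ((A *m z s) i 0)%:E + ((B *m u s) i 0)%:E)%E.
    by apply/funext => s; rewrite mxE EFinD.
  apply: integrableD => //; apply: integrable_mulmx => // k.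
    exact: trajectory_integrable trz tT.
  apply: integrableS (adu k) => //; exact: subset_itvl.
rewrite !mxE (tr1 i).2// (tr2 i).2// opprD addrACA; congr (_ + _).
rewrite -RintegralB//; [|exact: int_rhs..].
apply: eq_Rintegral => s _.
by rewrite mulmx0 addr0 mulmxBr !mxE opprD addrACA subrr addr0.
Qed.

(** Differentiating w z = 0 along z' = A z gives w A z = 0: applying w to the
    integral equation shows that the integral of w A z over [0, t] is
    w z(t) - w z(0) = 0.  Hypothesis and conclusion live on the same
    interval [0, T[, so the lemma can be iterated to reach every w A^e. *)
Lemma trajectory_annihilator q (w : 'M[R]_(q, n)) z : 0 < T ->
  is_trajectory A B T (fun=> 0) z ->
  (forall t, 0 <= t < T -> w *m z t = 0) ->
  forall t, 0 <= t < T -> (w *m A) *m z t = 0.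
Proof.
move=> T0 trz wz0 t tT; apply/matrixP => i j; rewrite ord1 [RHS]mxE.
move: t tT; apply: continuous_Rintegral_eq0 => //.
  by apply: within_continuous_mulmx => k; exact: (trz k).1.
move=> t tT; have /andP[t0 ltT] := tT.
under eq_Rintegral do rewrite -mulmxA.
rewrite Rintegral_mulmx//; last first.
  move=> k; apply: integrable_mulmx => // k'.
  exact: trajectory_integrable trz (ltW ltT).
transitivity ((w *m z t) i 0 - (w *m z 0) i 0); last first.
  by rewrite !wz0 ?lexx// !mxE subrr.
rewrite !mxE -sumrB; apply: eq_bigr => k _.
rewrite [in RHS](trz k).2 ?t0 ?ltW// mulrDr addrC addKr.
by congr (_ * _); apply: eq_Rintegral => s _; rewrite mulmx0 addr0.
Qed.

End Trajectories.

(** The vectors killed by all C A^e form the unobservable subspace.  Letting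
    e range over all naturals, instead of e < n as in the Kalman matrix, spares
    an appeal to the Cayley-Hamilton theorem. *)
Lemma observable_of_trivial_unobservable_subspace {R : realType} {n p q : nat}
    (A : 'M[R]_n) (B : 'M[R]_(n, p)) (C : 'M[R]_(q, n)) :
  (forall x : 'cV[R]_n, (forall e, C *m A ^+ e *m x = 0) -> x = 0) ->
  observable A B C.
Proof.
move=> kerO T u z1 z2 T0 adu tr1 tr2 eqC; apply: subr0_eq; apply: kerO.
have trd := trajectory_sub A B T u z1 z2 adu tr1 tr2.
suff CAe0 e t : 0 <= t < T -> C *m A ^+ e *m (z1 t - z2 t) = 0.
  by move=> e; apply: CAe0; rewrite lexx.
elim: e t => [|e IHe] t tT.
  rewrite expr0 mulmx1 mulmxBr eqC ?subrr//.
  by case/andP: tT => -> /ltW ->.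
rewrite exprSr -mulmxE mulmxA.
exact: (trajectory_annihilator _ _ _ _ _ _ T0 trd IHe).
Qed.

(** * Separation of the modes *)

(** Invertibility of the Vandermonde matrix.  By linearity the sum of the
    a j * P.[mu j] vanishes for every polynomial P; the unnormalized Lagrange
    polynomial vanishing at all nodes but mu j leaves only the j-th term. *)
Lemma power_sums_eq0 {F : idomainType} {N : nat} (mu a : 'I_N -> F) :
  injective mu -> (forall e, \sum_j a j * mu j ^+ e = 0) -> forall j, a j = 0.
Proof.
move=> mu_inj sum0 j.
have sumP0 (P : {poly F}) : \sum_i a i * P.[mu i] = 0.
  under eq_bigr do rewrite horner_coef mulr_sumr.
  rewrite exchange_big big1// => e _.
  under eq_bigr do rewrite mulrCA.
  by rewrite -mulr_sumr sum0 mulr0.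
pose L : {poly F} := \prod_(i | i != j) ('X - (mu i)%:P).
have L0 i : (L.[mu i] == 0) = (i != j).
  rewrite horner_prod; apply/idP/idP => [/prodf_eq0[k kj]|ij].
    rewrite hornerXsubC subr_eq0 => /eqP/mu_inj -> //.
  by rewrite (bigD1 i)//= hornerXsubC subrr mul0r.
have := sumP0 L; rewrite (bigD1 j)//= big1 ?addr0 => [|i ij]; last first.
  by apply/eqP; rewrite mulf_eq0 L0 ij orbT.
by move/eqP; rewrite mulf_eq0 L0 eqxx orbF => /eqP.
Qed.

(** * The control system in modal coordinates *)

Section ModalCoordinates.
Context {R : realType} {N : nat}.
Variable lambda : 'I_N -> R.

Definition modal_state (q p : 'I_N -> R) : 'cV[R]_(\sum_(j < N) 2) :=
  \mxcol_(j < N) (col_mx (q j)%:M (p j)%:M : 'M[R]_(1 + 1, 1)).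

Lemma modal_stateP (x : 'cV[R]_(\sum_(j < N) 2)) :
  exists q p, x = modal_state q p.
Proof.
pose block j : 'M[R]_(1 + 1, 1) := submxcol x j.
exists (fun j => usubmx (block j) 0 0), (fun j => dsubmx (block j) 0 0).
rewrite -[LHS]submxcolK; apply: eq_mxcol => j.
by rewrite -[LHS](@vsubmxK _ 1 1) -!mx11_scalar.
Qed.

Lemma mul_Amx_modal_state q p :
  Amx lambda *m modal_state q p =
  modal_state p (fun j => - lambda j * q j).
Proof.
rewrite mul_mxdiag_mxcol; apply: eq_mxcol => j.
rewrite [LHS](@mul_block_col _ 1 1 1 1 1) !mul0mx add0r addr0 mul1mx.
by rewrite -scalar_mxM.
Qed.

(** A squared acts on the j-th block as the scalar - lambda j. *)
Lemma exp_Amx_modal_state e q p :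
  Amx lambda ^+ (2 * e) *m modal_state q p =
  modal_state (fun j => (- lambda j) ^+ e * q j)
              (fun j => (- lambda j) ^+ e * p j).
Proof.
elim: e => [|e IHe].
  by rewrite muln0 mul1mx; apply: eq_mxcol => j; rewrite !mul1r.
rewrite mulnS exprD -mulmxE -mulmxA IHe expr2 -mulmxE -mulmxA.
by rewrite !mul_Amx_modal_state; apply: eq_mxcol => j; rewrite !exprS !mulrA.
Qed.

Lemma mul_Cmx_modal_state (r : nat) (l l0 : R) (sensor : 'I_r -> R) W q p s :
  (Cmx l l0 sensor W *m modal_state q p) s 0 =
  \sum_j ccoef l l0 sensor W s j * q j.
Proof.
rewrite mul_mxrow_mxcol summxE; apply: eq_bigr => j _.
by rewrite (@mul_row_col _ r.+1 1 1 1) mul0mx addr0 mul_mx_scalar !mxE mulrC.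
Qed.

End ModalCoordinates.

Theorem lemma3 (R : realType) (l l0 rho E I m kappa : R)
  (hl : 0 < l) (hl0 : 0 < l0 < l)
  (hrho : 0 < rho) (hE : 0 < E) (hI : 0 < I) (hm : 0 < m) (hkappa : 0 < kappa)
  (N k r : nat) (hN : (1 <= N)%N)
  (psi : 'I_k -> R -> R)
  (hpsi : forall i,
     (@lebesgue_measure R).-integrable `[0, l] (fun x => (psi i x)%:E))
  (hsupp : forall i, supp_on `[0, l] (psi i) `&` [set 0; l0; l] = set0)
  (sensor : 'I_r -> R) (hsensor : forall s, 0 <= sensor s <= l)
  (lambda : 'I_N -> R) (W : 'I_N -> R -> R)
  (hW : forall j, is_eigenpair l l0 rho E I m kappa (lambda j) (W j))
  (hdistinct : injective lambda)
  (hc : forall j, exists s, ccoef l l0 sensor W s j != 0) :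
  observable (Amx lambda) (Bmx l l0 rho m psi W) (Cmx l l0 sensor W).
Proof.
apply: observable_of_trivial_unobservable_subspace => x Ox.
have [q [p xE]] := modal_stateP x; rewrite {x}xE in Ox *.
have oppl_inj : injective (fun j => - lambda j).
  by move=> i j /oppr_inj/hdistinct.
(* The separation is applied with the sensor s chosen to see the mode j. *)
have coef0 (v : 'I_N -> R) :
    (forall e s,
      \sum_j ccoef l l0 sensor W s j * v j * (- lambda j) ^+ e = 0) ->
    forall j, v j = 0.
  move=> sum0 j; have [s cs0] := hc j.
  have /eqP := power_sums_eq0 _ (fun j => ccoef l l0 sensor W s j * v j)
    oppl_inj (sum0^~ s) j.
  by rewrite mulf_eq0 (negPf cs0) => /eqP.
(* Even powers of A give the positions, odd powers the velocities. *)
have q0 : forall j, q j = 0.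
  apply: coef0 => e s; have /matrixP/(_ s 0) := Ox (2 * e)%N.
  rewrite -mulmxA exp_Amx_modal_state mul_Cmx_modal_state mxE => Oxs.
  rewrite -[RHS]Oxs.
  by apply: eq_bigr => j _; rewrite mulrAC -mulrA.
have p0 : forall j, p j = 0.
  apply: coef0 => e s; have /matrixP/(_ s 0) := Ox (2 * e).+1%N.
  rewrite exprSr -mulmxE -!mulmxA mul_Amx_modal_state exp_Amx_modal_state.
  rewrite mul_Cmx_modal_state mxE => Oxs.
  rewrite -[RHS]Oxs.
  by apply: eq_bigr => j _; rewrite mulrAC -mulrA.
rewrite -[RHS]mxcol0; apply: eq_mxcol => j.
by rewrite q0 p0 raddf0 col_mx0.
Qed.
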